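(* Let $P$ be a $\mu$-invariant Markov kernel on a normed space $E$ with norm $|\cdot|$. Assume that for some $t>0$, $$\mu\left(\mathcal{B}(0,\rho)^{\complement}\right)=\rho^{-t},\qquad\rho\ge1 .$$ Assume there exist $D,\eta>0$ such that $$b(K)\ge1-DK^{-\eta},\qquad K>0,$$ where $b(r):=\inf_{x\in E}P(x,\mathcal{B}(x,r))$. Then $\beta^\star(s)\in\Omega\left(s^{-t\frac{\eta+1}{\eta}}\right)$ as $s\to\infty$.
   Context: $E$ is a real normed vector space equipped with a $\sigma$-algebra $\mathscr{E}$ for which $(x,y)\mapsto|x-y|$ and $x\mapsto|x|$ are measurable (e.g. $\mathbb{R}^d$ with its Borel sets), and $\mu$ is a probability measure on $(E,\mathscr{E})$. $\mathcal{B}(x,r)=\{y\in E:|y-x|\le r\}$. $\beta^\star(s)=\sup\{\|g\|_2^2-s\,\mathcal{E}(P,g):g\in L^2_0(\mu),\ \|g\|_{\mathrm{osc}}=1\}\vee0$, where $L^2_0(\mu)$ is the set of real $g\in L^2(\mu)$ with $\mu(g)=0$, $\|g\|_{\mathrm{osc}}=\mathrm{ess}_\mu\sup g-\mathrm{ess}_\mu\inf g$, and $\mathcal{E}(P,g)=\langle(\mathrm{Id}-P)g,g\rangle$ in $L^2(\mu)$. (It is the pointwise minimal $\beta$ such that $\|f\|_2^2\le s\,\mathcal{E}(P,f)+\beta(s)\|f\|_{\mathrm{osc}}^2$ for all $s>0$ and $f\in L_0^2(\mu)$.) $f(s)\in\Omega(g(s))$ as $s\to\infty$ means $\liminf_{s\to\infty}|f(s)/g(s)|>0$.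 *)

(* Defs.v *)
From HB Require Import structures.
From mathcomp Require Import all_boot all_order all_algebra.
From mathcomp Require Import all_classical all_reals all_analysis.
From mathcomp Require Import ess_sup_inf hoelder kernel.
Set Implicit Arguments.
Unset Strict Implicit.
Unset Printing Implicit Defensive.
Import Order.TTheory GRing.Theory Num.Theory.
Import numFieldNormedType.Exports.
Local Open Scope classical_set_scope.
Local Open Scope ring_scope.

(* The sigma-algebra is not assumed to be related to the norm topology; the
   measurability requirements are stated by [norm_measurable]. *)
#[short(type=measurableNormedModType)]
HB.structure Definition MeasurableNormedModule (d : measure_display)
    (R : realType) :=
  {E of NormedModule R E & Measurable d E}.

Definition norm_measurable (d : measure_display) (R : realType)
    (E : measurableNormedModType d R) : Prop :=
  measurable_fun [set: E * E] (fun z : E * E => `|z.1 - z.2|) /\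
  measurable_fun [set: E] (fun x : E => `|x|).

Section markov.
Context (d : measure_display) (T : measurableType d) (R : realType).
Implicit Types (mu : probability T R) (P : R.-pker T ~> T) (f g : T -> R).

Definition invariant_measure mu P : Prop :=
  forall A : set T, measurable A -> (\int[mu]_x P x A = mu A)%E.

(* For f in L^1(mu) and P mu-invariant, f is P(x, .)-integrable for mu-almost
   every x; [Rintegral] is junk on the remaining null set. *)
Definition markov_op P f : T -> R := fun x => \int[P x]_y f y.

Definition L2_inner mu f g : R := \int[mu]_x (f x * g x).

Definition dirichlet mu P g : R := L2_inner mu (fun x => g x - markov_op P g x) g.

Definition osc mu g : \bar R :=
  (ess_sup mu (EFin \o g) - ess_inf mu (EFin \o g))%E.

(* Functions rather than classes: every functional below is invariant under
   modification of g on a mu-null set (for mu-invariant P). *)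
Definition L2_0 mu : set (T -> R) :=
  [set g | g \in Lfun mu 2%:E /\ \int[mu]_x g x = 0].

Definition beta_star mu P (s : R) : \bar R :=
  maxe (ereal_sup [set ('N[mu]_2%:E[EFin \o g] ^+ 2 - (s * dirichlet mu P g)%:E)%E
                  | g in [set g | L2_0 mu g /\ osc mu g = 1%:E]])
       0%E.

End markov.

(* [closed_ball_ Num.norm x r] is {y | |x - y| <= r}, for every real r. *)
Definition min_ball_prob (d : measure_display) (R : realType)
    (E : measurableNormedModType d R) (P : R.-pker E ~> E) (r : R) : \bar R :=
  ereal_inf (range (fun x : E => P x (closed_ball_ Num.norm x r))).

Definition liminf_Omega (R : realType) (f : R -> \bar R) (g : R -> R) : Prop :=
  (0 < limf_einf (fun s : R => `|f s / (g s)%:E|) (pinfty_nbhs R))%E.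

(* Main.v *)
Require Import Defs.
From HB Require Import structures.
From mathcomp Require Import all_boot all_order all_algebra.
From mathcomp Require Import all_classical all_reals all_analysis.
From mathcomp Require Import measurable_realfun ess_sup_inf hoelder kernel.
From mathcomp Require Import ring lra.
Set Implicit Arguments.
Unset Strict Implicit.
Unset Printing Implicit Defensive.
Import Order.TTheory GRing.Theory Num.Theory.
Import numFieldNormedType.Exports.
Local Open Scope classical_set_scope.
Local Open Scope ring_scope.

(* Test the functional on [g = 1_A - mu A] with [A = {|x| > rho}], for which
   [E(P, g)] is the integral over [A] of [P(x, ~` A)]. With
   [B = {|x| > rho + K}], the shell [A \ B] contributes at most
   [mu A - mu B <= (t K / rho) mu A], and on [B] the ball [B(x, K)] stays in
   [A], so that [P(x, ~` A) <= D K ^ (- eta)]. Taking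
   [K = (8 D s) ^ (1 / eta)] and [rho = 8 t s K] bounds each of the two
   contributions to [s E(P, g)] by [mu A / 8], and
   [mu A = rho ^ (- t)] is a multiple of [s ^ (- t (eta + 1) / eta)]. *)

(** * Essential suprema and integration for measures of total mass one *)

(** An essential upper bound below [c] would be violated at every point of [A], making [A]
    negligible. *)
Lemma ess_sup_ge_on (d : measure_display) (T : measurableType d) (R : realType)
    (mu : {measure set T -> \bar R}) (A : set T) (f : T -> \bar R) (c : \bar R) :
  measurable A -> (0 < mu A)%E -> (forall x, A x -> (c <= f x)%E) ->
  (c <= ess_sup mu f)%E.
Proof.
move=> mA A0 cf; apply: le_ereal_inf_tmp => y fy; rewrite leNgt.
apply/negP => yc; move: A0; rewrite (measure_negligible mA) ?ltxx//.
apply: negligibleS fy => x Ax /= fxy.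
by have := lt_le_trans yc (le_trans (cf _ Ax) fxy); rewrite ltxx.
Qed.

Section integration.
Context {d : measure_display} {T : measurableType d} {R : realType}.
(** Total mass one is assumed of a bare measure so that the lemmas serve both [mu] and every
    [P x]. *)
Context {mu : {measure set T -> \bar R}} (mu1 : mu [set: T] = 1%E).

Lemma fin_num_mass1 (A : set T) : measurable A -> mu A \is a fin_num.
Proof.
move=> mA; rewrite ge0_fin_numE//; apply: (@le_lt_trans _ _ 1%E); last exact: ltry.
by rewrite -mu1 le_measure ?inE.
Qed.

Lemma bounded_integrableT (f : T -> R) (M : R) : measurable_fun setT f ->
  (forall x, `|f x| <= M) -> mu.-integrable setT (EFin \o f).
Proof.
move=> mf fM; apply: measurable_bounded_integrable => //.
  by rewrite mu1 ltry.
exists M; split; first exact: num_real.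
by move=> N MN x _; exact: le_trans (fM x) (ltW MN).
Qed.

Lemma Rintegral_indic (A : set T) : measurable A ->
  \int[mu]_x \1_A x = fine (mu A) :> R.
Proof. by move=> mA; rewrite /Rintegral integral_indic// setIT. Qed.

Lemma integrable_indicT (A : set T) : measurable A ->
  mu.-integrable setT (EFin \o (\1_A : T -> R)).
Proof.
move=> mA; apply: (@bounded_integrableT _ 1); first exact: measurable_indic.
by move=> x; rewrite indicE; case: (_ \in _); rewrite ?normr1 ?normr0.
Qed.

Lemma Rintegral_cstT (r : R) : \int[mu]_x r = r.
Proof. by rewrite Rintegral_cst// mu1 mulr1. Qed.

Lemma integrable_mull (f : T -> R) (k : R) : mu.-integrable setT (EFin \o f) ->
  mu.-integrable setT (EFin \o (fun x => k * f x)).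
Proof. by move=> /(integrableZl measurableT k). Qed.

End integration.

(** * Centered indicators: variance, oscillation and Dirichlet form *)

Section centered_indicator.
Context {d : measure_display} {T : measurableType d} {R : realType}.
Variables (mu : probability T R) (A : set T).
Hypothesis mA : measurable A.

Let a : R := fine (mu A).

Definition centered_indic (x : T) : R := \1_A x - a.

Let mu1 : mu [set: T] = 1%E. Proof. exact: probability_setT. Qed.

Let muA : mu A = a%:E.
Proof. by rewrite fineK// fin_num_mass1. Qed.

Let a01 : 0 <= a <= 1.
Proof. by rewrite -!lee_fin -muA measure_ge0 probability_le1. Qed.

Let measurable_centered_indic : measurable_fun setT centered_indic.
Proof. by apply: measurable_funB => //; exact: measurable_indic. Qed.

Let integrable_indicA : mu.-integrable setT (EFin \o (\1_A : T -> R)).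
Proof. exact: integrable_indicT. Qed.

Let integrable_cst (r : R) : mu.-integrable setT (EFin \o cst r).
Proof. by apply: (bounded_integrableT mu1 (M := `|r|)). Qed.

Let RintegralA : \int[mu]_x \1_A x = a.
Proof. exact: Rintegral_indic. Qed.

(** This is the Bernoulli variance: as [\1_A] is idempotent, the square is affine in [\1_A], and
    only the integral of [\1_A] is needed. *)
Let Rintegral_sqr : \int[mu]_x (centered_indic x ^+ 2) = a * (1 - a).
Proof.
rewrite (_ : a * (1 - a) = (1 - 2 * a) * a + a ^+ 2); last by ring.
under eq_Rintegral => x _.
  rewrite (_ : _ ^+ 2 = (1 - 2 * a) * \1_A x + a ^+ 2); last first.
    by rewrite /centered_indic indicE; case: (_ \in _) => /=; ring.
  over.
rewrite RintegralD//; last exact: integrable_cst.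
  by rewrite RintegralZl// RintegralA Rintegral_cstT.
exact: integrable_mull.
Qed.

Let centered_indic_le1 x : `|centered_indic x| <= 1.
Proof.
have [a0 a1] := andP a01.
rewrite /centered_indic indicE ler_norml.
by case: (_ \in _) => /=; apply/andP; split; lra.
Qed.

Let sqr_Lnorm : ('N[mu]_2%:E[EFin \o centered_indic] `^ 2 = (a * (1 - a))%:E)%E.
Proof.
rewrite powR_Lnorm ?pnatr_eq0//.
under eq_integral => x _.
  rewrite /= powR_mulrn// real_normK ?num_real//.
  over.
rewrite -Rintegral_sqr /Rintegral fineK//.
apply: integrable_fin_num => //.
apply: (bounded_integrableT mu1 (M := 1)).
  by apply: measurable_funX.
by move=> x; rewrite normrX expr_le1.
Qed.

(** Passes from the real exponent, natural for ['N[mu]_2%:E], to the integer exponent in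
    [beta_star]. *)
Lemma Lnorm2_centered_indic :
  ('N[mu]_2%:E[EFin \o centered_indic] ^+ 2 = (a * (1 - a))%:E)%E.
Proof.
rewrite -sqr_Lnorm (_ : 2 = 1 + 1 :> R)%R// poweRD ?add_neq0_poweRD_def//.
by rewrite !poweRe1 ?Lnorm_ge0.
Qed.

Lemma centered_indic_L2_0 : L2_0 mu centered_indic.
Proof.
split.
  rewrite inE/=; apply/andP; split; rewrite inE//=.
  have : ('N[mu]_2%:E[EFin \o centered_indic] `^ 2 < +oo)%E.
    by rewrite sqr_Lnorm ltry.
  by apply: lty_poweRy; rewrite pnatr_eq0.
rewrite RintegralB//=; last exact: integrable_cst.
by rewrite Rintegral_indic// Rintegral_cstT// subrr.
Qed.

(** For [0 < a < 1] both [A] and its complement have positive mass, so the two values [1 - a] and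
    [- a] are the essential extrema, at distance 1. *)
Lemma osc_centered_indic : 0 < a < 1 -> osc mu centered_indic = 1%:E.
Proof.
move=> /andP[a_gt0 a_lt1].
have muCA : mu (~` A) = (1 - a)%:E by rewrite probability_setC// muA.
rewrite /osc; have -> : ess_sup mu (EFin \o centered_indic) = (1 - a)%:E.
  apply/eqP; rewrite eq_le; apply/andP; split.
    apply: ess_sup_ler => x; rewrite lee_fin /centered_indic indicE.
    by case: (_ \in _) => /=; lra.
  apply: (@ess_sup_ge_on _ _ _ _ A) => //; first by move: a_gt0; rewrite -lte_fin -muA.
  by move=> x Ax; rewrite /centered_indic /= indicE mem_set.
have -> : ess_inf mu (EFin \o centered_indic) = (- a)%:E.
  apply/eqP; rewrite eq_le; apply/andP; split; last first.
    apply: ess_inf_ler => x; rewrite lee_fin /centered_indic indicE.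
    by case: (_ \in _) => /=; lra.
  rewrite ess_infEN EFinN leeN2.
  apply: (@ess_sup_ge_on _ _ _ _ (~` A)) => //.
  - exact: measurableC.
  - by move: a_lt1; rewrite -subr_gt0 -lte_fin -muCA.
  - by move=> x Ax; rewrite /centered_indic /= indicE memNset// sub0r opprK.
by rewrite -EFinB; congr EFin; ring.
Qed.

Variables (P : R.-pker T ~> T) (hP : invariant_measure mu P).

Let p (x : T) : R := fine (P x A).

Let PE x : P x A = (p x)%:E.
Proof. by rewrite /p fineK// (fin_num_mass1 (prob_kernel x)). Qed.

Let p01 x : 0 <= p x <= 1.
Proof.
by rewrite -!lee_fin -PE measure_ge0 /= -(prob_kernel (s := P) x) le_measure ?inE.
Qed.

Let measurable_p : measurable_fun setT p.
Proof.
apply: measurableT_comp; first exact: fine_measurable.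
exact: measurable_kernel.
Qed.

Let integrable_p : mu.-integrable setT (EFin \o p).
Proof.
apply: (bounded_integrableT mu1 (M := 1)) => // x.
by have /andP[p0 p1] := p01 x; rewrite ger0_norm.
Qed.

(** Invariance of [mu] enters here. *)
Let Rintegral_p : \int[mu]_x p x = a.
Proof.
rewrite /Rintegral /a -hP//; congr fine.
by apply: eq_integral => x _; rewrite PE.
Qed.

Let markov_op_centered_indic x : markov_op P centered_indic x = p x - a.
Proof.
have P1 := prob_kernel (s := P) x.
rewrite /markov_op RintegralB//=.
- by rewrite Rintegral_indic// Rintegral_cstT.
- exact: integrable_indicT.
- by apply: (bounded_integrableT P1 (M := `|a|)).
Qed.

(** The form equals the integral over [A] of the escape probability [1 - p]. This is at most [e] on
    [B] and at most 1 on the rest of [A], whence the pointwise bound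
    [h <= \1_A - (1 - e) * \1_B]. *)
Lemma dirichlet_centered_indic_le (B : set T) (e : R) :
  measurable B -> B `<=` A -> (forall x, B x -> ((1 - e)%:E <= P x A)%E) ->
  dirichlet mu P centered_indic <= a - (1 - e) * fine (mu B).
Proof.
move=> mB BA PB; set b := fine (mu B).
pose h (x : T) : R := \1_A x * (1 - p x).
have ih : mu.-integrable setT (EFin \o h).
  apply: (bounded_integrableT mu1 (M := 1)).
    by apply: measurable_funM => //; apply: measurable_funB.
  move=> x; have /andP[p0 p1] := p01 x.
  by rewrite /h indicE ler_norml; case: (_ \in _) => /=; apply/andP; split; lra.
have iq : mu.-integrable setT (EFin \o (fun x => \1_A x - p x)).
  exact: (integrableB measurableT integrable_indicA integrable_p).
have iB : mu.-integrable setT (EFin \o (\1_B : T -> R)) by exact: integrable_indicT.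
have -> : dirichlet mu P centered_indic = \int[mu]_x h x.
  rewrite /dirichlet /L2_inner.
  under eq_Rintegral => x _.
    rewrite markov_op_centered_indic.
    (* The subtracted term integrates to 0, because [\1_A] and [p] have the same mean. *)
    rewrite (_ : _ * _ = h x - a * (\1_A x - p x)); last first.
      by rewrite /centered_indic /h indicE; case: (_ \in _) => /=; ring.
    over.
  rewrite RintegralB//=; last exact: integrable_mull.
  by rewrite RintegralZl// RintegralB// RintegralA Rintegral_p subrr mulr0 subr0.
have -> : a - (1 - e) * b = \int[mu]_x (\1_A x - (1 - e) * \1_B x).
  rewrite RintegralB//=; last exact: integrable_mull.
  by rewrite RintegralZl// RintegralA Rintegral_indic.
apply: le_Rintegral => //.
  exact: (integrableB measurableT integrable_indicA (integrable_mull (1 - e) iB)).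
move=> x _; have /andP[p0 p1] := p01 x.
rewrite /h !indicE; have [Bx|nBx] := pselect (B x).
  rewrite !mem_set//=; last exact: BA.
  by have := PB x Bx; rewrite PE lee_fin; lra.
by rewrite (memNset nBx); case: (_ \in _) => /=; lra.
Qed.

Lemma beta_star_ge_indic (B : set T) (e s : R) : 0 < a < 1 -> 0 <= s ->
  measurable B -> B `<=` A -> (forall x, B x -> ((1 - e)%:E <= P x A)%E) ->
  ((a * (1 - a) - s * (a - (1 - e) * fine (mu B)))%:E <= beta_star mu P s)%E.
Proof.
move=> a_01 s0 mB BA PB; rewrite /beta_star le_max; apply/orP; left.
apply: (@le_trans _ _ ((a * (1 - a))%:E - (s * dirichlet mu P centered_indic)%:E)%E).
  rewrite -EFinB lee_fin lerD2l lerN2 ler_wpM2l//.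
  exact: dirichlet_centered_indic_le.
rewrite -Lnorm2_centered_indic; apply: ereal_sup_ubound => /=.
exists centered_indic => //; split; first exact: centered_indic_L2_0.
exact: osc_centered_indic.
Qed.

End centered_indicator.

(** * Analytic and geometric estimates *)

(** Combines [exp y >= 1 + y] at [y = - t * ln (1 + u)] with [ln (1 + u) <= u]. It bounds from below
    the fraction of the tail mass left after enlarging the radius. *)
Lemma powR_1D_ge (R : realType) (u t : R) : 0 <= u -> 0 <= t ->
  1 - t * u <= (1 + u) `^ (- t).
Proof.
move=> u0 t0; rewrite /powR gt_eqF; last by lra.
apply: le_trans (expR_ge1Dx _).
rewrite mulNr lerD2l lerN2 ler_wpM2l// le_ln1Dx//; lra.
Qed.

Lemma liminf_Omega_ge (R : realType) (f : R -> \bar R) (g : R -> R) (c : R) :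
  0 < c -> (\forall s \near +oo, 0 < g s /\ ((c * g s)%:E <= f s)%E) ->
  liminf_Omega f g.
Proof.
move=> c0 cgf; rewrite /liminf_Omega limf_einfE.
apply: (@lt_le_trans _ _ c%:E); first by rewrite lte_fin.
apply: le_trans; last first.
  (* The lower limit is a supremum of infima over neighbourhoods of infinity; the set where the
     bound holds is one of them. *)
  by apply: ereal_sup_ubound; exists (fun s => 0 < g s /\ ((c * g s)%:E <= f s)%E).
apply: le_ereal_inf_tmp => _ [s [gs0 cgs] <-].
apply: le_trans (lee_abs _).
(* Positivity of [g s] excludes the special value of the inverse at 0. *)
by rewrite inver gt_eqF// lee_pdivlMr.
Qed.

Lemma measurable_closed_ball_norm (d : measure_display) (R : realType)
    (E : measurableNormedModType d R) (x : E) (r : R) :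
  norm_measurable E -> measurable (closed_ball_ Num.norm x r).
Proof.
move=> [hE _]; rewrite -[X in measurable X]setTI.
apply: (measurable_fun_le measurableT (f := fun y => `|x - y|) (g := cst r)) => //.
exact: (measurableT_comp hE (pair1_measurable x)).
Qed.

(** If [|y| <= rho] and [|x - y| <= K], the triangle inequality gives [|x| <= rho + K]. *)
Lemma closed_ball_far (R : realType) (E : normedModType R) (x : E) (rho K : R) :
  (~` closed_ball_ Num.norm (0 : E) (rho + K)) x ->
  closed_ball_ Num.norm x K `<=` ~` closed_ball_ Num.norm (0 : E) rho.
Proof.
rewrite /closed_ball_ /= => xK y xy yr.
apply: xK; rewrite /= !sub0r !normrN in xy yr *; rewrite -(subrK y x) (addrC rho).
by apply: le_trans (ler_normD _ _) _; apply: lerD.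
Qed.

(** * Choice of the scales and the lower bound *)

Theorem proposition93 (d : measure_display) (R : realType)
    (E : measurableNormedModType d R) (hE : norm_measurable E)
    (mu : probability E R) (P : R.-pker E ~> E) (hP : invariant_measure mu P)
    (t : R) (t_gt0 : 0 < t)
    (mu_tail : forall rho : R, 1 <= rho ->
      mu (~` closed_ball_ Num.norm (0 : E) rho) = (rho `^ (- t))%:E)
    (D eta : R) (D_gt0 : 0 < D) (eta_gt0 : 0 < eta)
    (P_ball : forall K : R, 0 < K ->
      ((1 - D * K `^ (- eta))%:E <= min_ball_prob P K)%E) :
  liminf_Omega (beta_star mu P) (fun s : R => s `^ (- (t * ((eta + 1) / eta)))).
Proof.
(* [C] is the factor for which [rho = C * s ^ ((eta + 1) / eta)]. *)
pose C : R := 8 * t * (8 * D) `^ eta^-1.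
have C_gt0 : 0 < C by rewrite !mulr_gt0// powR_gt0 ?mulr_gt0.
(* The functional will be at least [a / 4] with [a = mu A]: the variance is at least [a / 2] and the
   Dirichlet term costs at most [a / 4]. *)
apply: (@liminf_Omega_ge _ _ _ (C `^ (- t) / 4)).
  by rewrite divr_gt0// powR_gt0.
near=> s.
have s1 : 1 <= s by near: s; apply: nbhs_pinfty_ge; exact: num_real.
have s_gt0 : 0 < s by exact: lt_le_trans s1.
(* This threshold makes [rho >= 2 ^ (1 / t)], hence [a <= 1 / 2], and also [rho >= 1], where the
   tail formula applies. *)
have sC : 2 `^ t^-1 / C <= s by near: s; apply: nbhs_pinfty_ge; exact: num_real.
split; first exact: powR_gt0.
pose K := (8 * D * s) `^ eta^-1.
have K_gt0 : 0 < K by rewrite powR_gt0// !mulr_gt0.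
pose rho := 8 * t * s * K.
have etaE : (eta + 1) / eta = 1 + eta^-1 by field; rewrite gt_eqF.
have rhoE : rho = C * s `^ ((eta + 1) / eta).
  rewrite /rho /K /C powRM// ?mulr_ge0 ?ltW//.
  rewrite etaE powRD; last by rewrite (gt_eqF s_gt0) implybT.
  by rewrite powRr1 ?(ltW s_gt0)//; ring.
have rho_gt0 : 0 < rho by rewrite !mulr_gt0.
have rho_ge : 2 `^ t^-1 <= rho.
  rewrite rhoE mulrC -ler_pdivrMr//; apply: le_trans sC _.
  apply: le1r_powR => //.
  by rewrite etaE lerDl invr_ge0 ltW.
have two_ge1 : 1 <= 2 `^ t^-1 :> R.
  by rewrite -[leLHS](powRr0 2) ler_powR ?invr_ge0 ?(ltW t_gt0)// ler1n.
have rho1 : 1 <= rho := le_trans two_ge1 rho_ge.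
pose a := rho `^ (- t).
have a_gt0 : 0 < a by exact: powR_gt0.
have a_le : a <= 1 / 2.
  rewrite /a powRN div1r lef_pV2 ?posrE ?powR_gt0//.
  rewrite (_ : 2 = (2 `^ t^-1) `^ t :> R); last first.
    by rewrite -powRrM mulVf ?powRr1// gt_eqF.
  by apply: ge0_ler_powR; rewrite ?nnegrE ?powR_ge0 ?(ltW t_gt0) ?(ltW rho_gt0).
have aE : a = C `^ (- t) * s `^ (- (t * ((eta + 1) / eta))).
  by rewrite /a rhoE powRM ?powR_ge0 ?(ltW C_gt0)// -powRrM mulrN (mulrC t).
(* One [e] plays two parts: it equals both the escape bound [D * K ^ (- eta)] and the relative shell
   mass bound [t * K / rho]. *)
pose e := (8 * s)^-1.
have e_gt0 : 0 < e by rewrite invr_gt0 mulr_gt0.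
have se : s * e = 1 / 8 by rewrite /e; field; rewrite gt_eqF.
have eK : D * K `^ (- eta) = e.
  rewrite /K -powRrM mulrN mulVf ?gt_eqF// powR_inv1 ?mulr_ge0 ?ltW//.
  by rewrite /e; field; rewrite !gt_eqF.
(* [powR_1D_ge] at [u = K / rho], where [t * u = e]. *)
have b_ge : a * (1 - e) <= (rho + K) `^ (- t).
  have -> : rho + K = rho * (1 + K / rho) by field; rewrite gt_eqF.
  have u0 : 0 <= K / rho by rewrite divr_ge0// ltW.
  rewrite powRM ?(ltW rho_gt0)//; last by rewrite addr_ge0.
  rewrite ler_pM2l//; apply: le_trans (powR_1D_ge u0 (ltW t_gt0)).
  rewrite lerD2l lerN2 le_eqVlt; apply/orP; left; apply/eqP.
  by rewrite /rho /e; field; rewrite !gt_eqF.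
pose A : set E := ~` closed_ball_ Num.norm (0 : E) rho.
pose B : set E := ~` closed_ball_ Num.norm (0 : E) (rho + K).
have mball (x : E) r := measurable_closed_ball_norm x r hE.
have mA : measurable A by exact: measurableC.
have mB : measurable B by exact: measurableC.
have muA : fine (mu A) = a by rewrite mu_tail.
have muB : fine (mu B) = (rho + K) `^ (- t).
  by rewrite mu_tail// (le_trans rho1)// lerDl ltW.
have BA : B `<=` A.
  move=> x; apply: contra_not; rewrite /closed_ball_ /= => /le_trans; apply.
  by rewrite lerDl ltW.
have PB x : B x -> ((1 - e)%:E <= P x A)%E.
  move=> Bx; rewrite -eK; apply: (le_trans (P_ball _ K_gt0)).
  apply: (@le_trans _ _ (P x (closed_ball_ Num.norm x K))).
    by apply: ereal_inf_lbound; exists x.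
  by rewrite le_measure ?inE//; exact: closed_ball_far.
have a01 : 0 < fine (mu A) < 1 by rewrite muA; lra.
apply: le_trans (beta_star_ge_indic mA hP a01 (ltW s_gt0) mB BA PB).
rewrite lee_fin muA muB mulrAC -aE.
have e_le : e <= 1 / 8 by rewrite -se ler_peMl// ltW.
have sb : s * (1 - e) * (a * (1 - e)) <= s * (1 - e) * (rho + K) `^ (- t).
  by rewrite ler_wpM2l// mulr_ge0 ?(ltW s_gt0)//; lra.
have aa : a * a <= a * (1 / 2) by rewrite ler_wpM2l// ltW.
have ae : 0 <= a * e by rewrite mulr_ge0// ltW.
(* Expanding [(1 - e) ^ 2] and using [s * e = 1 / 8] cancels the large term [s * a] of the Dirichlet
   cost and leaves a loss of [a / 4], up to a nonnegative remainder. *)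
have sE : s * (1 - e) * (a * (1 - e)) = s * a - a / 4 + a * e / 8.
  rewrite [LHS](_ : _ = s * a - 2 * a * (s * e) + a * e * (s * e)); last by ring.
  by rewrite se; field.
rewrite sE in sb; lra.
Unshelve. all: by end_near.
Qed.
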